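(* Let $\mathsf{N}$ be the set of $\mathrm{N}$-valid propositional formulas and let $\mathsf{CL}$ be the set of classically valid propositional formulas. Then $\mathsf{N}\subsetneq\mathsf{CL}$.
   Context: Formulas are built from a fixed nonempty set of atoms using $\neg,\vee,\wedge,\rightarrow$. There are three symbolic attack expressions $?$, $\wedge_L$, $\wedge_R$, distinct from all formulas and connectives. A statement is a formula or a symbolic attack. The two players are $P$ (Proponent) and $O$ (Opponent). A signed expression is a pair $\langle A,e\rangle$ with $A\in\{P,O\}$ and $e$ a statement. Particle rules: $\alpha\wedge\beta$ may be attacked by $\wedge_L$ (response: $\alpha$) or by $\wedge_R$ (response: $\beta$); $\alpha\vee\beta$ is attacked by $?$ (response: $\alpha$ or $\beta$, at the defender's choice); $\alpha\rightarrow\beta$ is attacked by asserting $\alpha$ (response: $\beta$); $\neg\alpha$ is attacked by asserting $\alpha$ (there is no response). A dialogue commencing with $\phi$ is a pair $(\delta,\eta)$, where $\delta$ is a nonempty finite or infinite ($\omega$-indexed) sequence of signed expressions with $\delta(0)=\langle P,\phi\rangle$, and $\eta$ is a function with domain $\operatorname{dom}(\delta)\setminus\{0\}$ such that each $\eta(n)$ is a pair $[m,Z]$ with $m<n$ a natural number and $Z\in\{A,D\}$ ($A$ = attack, $D$ = defend), subject to: (1) $\delta(n)$ is $P$-signed if $n$ is even and $O$-signed if $n$ is odd; (2) if $\eta(n)=[m,A]$, then $\delta(m)$ was asserted by the other player (i.e. $n-m$ is odd), is a non-atomic formula, and $\delta(n)$ is an attack upon $\delta(m)$ according to the particle rules;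 (3) if $\eta(n)=[m,D]$, then $n-m$ is odd, $\eta(m)=[k,A]$ for some $k$, and $\delta(n)$ is a response, according to the particle rules, to the attack $\delta(m)$ upon $\delta(k)$. An $\mathrm{N}$-dialogue is a dialogue satisfying the two structural rules: ($\mathrm{D10}$) if $\delta(n)=\langle P,a\rangle$ with $a$ atomic, then there is $m<n$ with $\delta(m)=\langle O,a\rangle$ (this applies also to $n=0$); ($\mathrm{D13}$) if $m$ is even, there is at most one $n$ with $\eta(n)=[m,A]$. The $\mathrm{N}$-dialogue tree $T_\phi$ is the rooted tree of all $\mathrm{N}$-dialogues commencing with $\phi$: its nodes are the moves (the nodes at depth $n$ correspond to the $\mathrm{N}$-dialogues with domain $[0,n]$), children are one-move extensions, and a branch is a maximal chain containing the root. $P$ wins an $\mathrm{N}$-dialogue if its domain is $[0,2k]$ for some $k\in\mathbb{N}$ and it has no proper extension to an $\mathrm{N}$-dialogue. An $\mathrm{N}$-winning strategy (for $P$) for $\phi$ is a rooted subtree $s$ of $T_\phi$, with the same root, such that: every branch of $s$ is an $\mathrm{N}$-dialogue won by $P$; every node of $s$ at odd depth has exactly one child in $s$; every node of $s$ at even depth has the same children in $s$ as in $T_\phi$. A formula $\phi$ is $\mathrm{N}$-valid if there is an $\mathrm{N}$-winning strategy for $\phi$. *)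

(* Defs.v *)
From mathcomp Require Import all_boot.
From mathcomp Require Export classical_sets.
Set Implicit Arguments.
Unset Strict Implicit.
Unset Printing Implicit Defensive.
Local Open Scope classical_set_scope.

Inductive formula (Atom : Type) : Type :=
| Var of Atom
| Neg of formula Atom
| Or of formula Atom & formula Atom
| And of formula Atom & formula Atom
| Imp of formula Atom & formula Atom.

Definition is_atomic (Atom : Type) (f : formula Atom) : bool :=
  if f is Var _ then true else false.

Fixpoint eval (Atom : Type) (v : Atom -> bool) (f : formula Atom) : bool :=
  match f with
  | Var a => v a
  | Neg f1 => ~~ eval v f1
  | Or f1 f2 => eval v f1 || eval v f2
  | And f1 f2 => eval v f1 && eval v f2
  | Imp f1 f2 => eval v f1 ==> eval v f2
  end.

Definition classically_valid (Atom : Type) (phi : formula Atom) : Prop :=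
  forall v : Atom -> bool, eval v phi.

Inductive statement (Atom : Type) : Type :=
| Form of formula Atom
| Query
| AttackL
| AttackR.
Arguments Query {Atom}.
Arguments AttackL {Atom}.
Arguments AttackR {Atom}.

Inductive player : Type := Proponent | Opponent.

Definition signed_expr (Atom : Type) : Type := (player * statement Atom)%type.

(* [attacks f e]: [e] is an attack upon the formula [f]. *)
Inductive attacks (Atom : Type) : formula Atom -> statement Atom -> Prop :=
| attacks_andL f g : attacks (And f g) AttackL
| attacks_andR f g : attacks (And f g) AttackR
| attacks_or f g : attacks (Or f g) Query
| attacks_imp f g : attacks (Imp f g) (Form f)
| attacks_neg f : attacks (Neg f) (Form f).

(* [responds f e r]: [r] is a response to the attack [e] upon [f]. *)
Inductive responds (Atom : Type) :
  formula Atom -> statement Atom -> statement Atom -> Prop :=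
| responds_andL f g : responds (And f g) AttackL (Form f)
| responds_andR f g : responds (And f g) AttackR (Form g)
| responds_orL f g : responds (Or f g) Query (Form f)
| responds_orR f g : responds (Or f g) Query (Form g)
| responds_imp f g : responds (Imp f g) (Form f) (Form g).

Inductive mode : Type := Attack | Defend.

(* A pair (delta, eta) of partial functions on nat; [None] is "undefined". *)
Record move_sequence (Atom : Type) : Type := MoveSequence {
  delta : nat -> option (signed_expr Atom);
  eta : nat -> option (nat * mode)
}.

Definition mover (n : nat) : player := if odd n then Opponent else Proponent.

(* dom(delta) is a nonempty initial segment of nat, so that finite and
   omega-indexed sequences are treated uniformly. *)
Record dialogue (Atom : Type) (phi : formula Atom) (d : move_sequence Atom) :
    Prop := Dialogue {
  dialogue_start : delta d 0 = Some (Proponent, Form phi);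
  dialogue_dom : forall m n, m <= n -> isSome (delta d n) -> isSome (delta d m);
  dialogue_dom_eta : forall n, isSome (eta d n) = isSome (delta d n) && (n != 0);
  dialogue_backward : forall n m z, eta d n = Some (m, z) -> m < n;
  dialogue_sign : forall n p e, delta d n = Some (p, e) -> p = mover n;
  dialogue_attack : forall n m, eta d n = Some (m, Attack) ->
    odd (n - m) /\
    exists p f q e, [/\ delta d m = Some (p, Form f), ~~ is_atomic f,
                        delta d n = Some (q, e) & attacks f e];
  dialogue_defend : forall n m, eta d n = Some (m, Defend) ->
    odd (n - m) /\
    exists k, eta d m = Some (k, Attack) /\
    exists p f q e r x, [/\ delta d k = Some (p, Form f),
                            delta d m = Some (q, e),
                            delta d n = Some (r, x) & responds f e x]
}.

Definition D10 (Atom : Type) (d : move_sequence Atom) : Prop :=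
  forall n a, delta d n = Some (Proponent, Form (Var a)) ->
    exists2 m, m < n & delta d m = Some (Opponent, Form (Var a)).

Definition D13 (Atom : Type) (d : move_sequence Atom) : Prop :=
  forall m n n', ~~ odd m ->
    eta d n = Some (m, Attack) -> eta d n' = Some (m, Attack) -> n = n'.

Definition N_dialogue (Atom : Type) (phi : formula Atom)
    (d : move_sequence Atom) : Prop :=
  [/\ dialogue phi d, D10 d & D13 d].

(* d' extends d, not necessarily properly. *)
Definition extends (Atom : Type) (d d' : move_sequence Atom) : Prop :=
  forall n, isSome (delta d n) -> delta d' n = delta d n /\ eta d' n = eta d n.

(* The domain of d is [0, n]. *)
Definition has_depth (Atom : Type) (d : move_sequence Atom) (n : nat) : Prop :=
  forall i, isSome (delta d i) = (i <= n).

Definition P_wins (Atom : Type) (phi : formula Atom) (d : move_sequence Atom) :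
    Prop :=
  [/\ N_dialogue phi d,
      exists k, has_depth d k.*2 &
      forall d', N_dialogue phi d' -> extends d d' -> d' = d].

(* The node reached by a finite path of moves from the root is identified with
   the finite N-dialogue which that path spells out; the tree order is then
   [extends]. *)
Definition dialogue_tree (Atom : Type) (phi : formula Atom) :
    set (move_sequence Atom) :=
  [set d | N_dialogue phi d /\ exists n, has_depth d n].

Definition child (Atom : Type) (phi : formula Atom)
    (d d' : move_sequence Atom) : Prop :=
  [/\ dialogue_tree phi d, dialogue_tree phi d', extends d d' &
      exists n, has_depth d n /\ has_depth d' n.+1].

Definition root (Atom : Type) (phi : formula Atom) : move_sequence Atom :=
  MoveSequence (fun n => if n is 0 then Some (Proponent, Form phi) else None)
               (fun=> None).

(* [root phi] need not belong to the tree: for atomic phi the tree is empty,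
   and there are no subtrees. *)
Definition rooted_subtree (Atom : Type) (phi : formula Atom)
    (s : set (move_sequence Atom)) : Prop :=
  [/\ s `<=` dialogue_tree phi,
      s (root phi) &
      forall d d', child phi d d' -> s d' -> s d].

Definition branch (Atom : Type) (phi : formula Atom)
    (s b : set (move_sequence Atom)) : Prop :=
  [/\ b `<=` s,
      b (root phi),
      total_on b (@extends Atom) &
      forall b', b' `<=` s -> total_on b' (@extends Atom) -> b `<=` b' ->
        b' = b].

(* The branch b is the set of nonempty finite initial segments of d. *)
Definition branch_of_dialogue (Atom : Type) (phi : formula Atom)
    (b : set (move_sequence Atom)) (d : move_sequence Atom) : Prop :=
  b = [set x | dialogue_tree phi x /\ extends x d].

Record N_winning_strategy (Atom : Type) (phi : formula Atom)
    (s : set (move_sequence Atom)) : Prop := NWinningStrategy {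
  strategy_subtree : rooted_subtree phi s;
  strategy_branch : forall b, branch phi s b ->
    exists2 d, P_wins phi d & branch_of_dialogue phi b d;
  strategy_odd : forall d n, s d -> has_depth d n -> odd n ->
    exists! d', s d' /\ child phi d d';
  strategy_even : forall d n, s d -> has_depth d n -> ~~ odd n ->
    forall d', (s d' /\ child phi d d') <-> child phi d d'
}.

Definition N_valid (Atom : Type) (phi : formula Atom) : Prop :=
  exists s, N_winning_strategy phi s.

Definition N_valid_formulas (Atom : Type) : set (formula Atom) :=
  [set phi | N_valid phi].

Definition CL_valid_formulas (Atom : Type) : set (formula Atom) :=
  [set phi | classically_valid phi].

Arguments N_valid_formulas : clear implicits.
Arguments CL_valid_formulas : clear implicits.

(* Main.v *)
Require Import Defs.
From mathcomp Require Import all_boot classical_sets.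
From mathcomp Require Import boolp.
Local Open Scope classical_set_scope.

(** A winning strategy for the Proponent contains no infinite branch, so the
    Opponent refutes N-validity as soon as he can keep moving forever.  Both
    halves of the theorem come from this one principle ([opponent_stalls]): if
    some property of dialogues holds at the root, can always be preserved by
    some move of the Opponent, and survives every move of the Proponent, then
    the initial formula is not N-valid.

    Soundness.  Let the valuation [v] falsify the initial formula.  The
    Opponent asserts only formulas true under [v], and attacks only false
    formulas, choosing an attack after which every response is false (such as
    the left conjunct when that one fails).  Then he is never stuck.  If the
    Proponent has just asserted something false, it is not an atom, because D10
    lets the Proponent assert only atoms the Opponent asserted, and those are
    true; so it can be attacked ([attack_false]).  Otherwise the Proponent has
    attacked a true formula without asserting anything false, and there is a
    true response ([answer_true]).  A defence by the Proponent is always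
    false, by the choice of the Opponent's attacks.

    Strictness.  Nothing stops the Opponent from repeating a defence, so the
    Proponent loses whenever she attacks a formula that admits a response.  In
    a dialogue for the tautology [(a /\ a) -> a] she is forced to do so: after
    the Opponent's opening attack, D10 forbids her the answer [a], and only the
    attacks on [a /\ a] remain ([conj_elim_not_N_valid]). *)

(** * Finite dialogues and their extensions *)

Section Play.
Set Implicit Arguments.
Unset Strict Implicit.
Unset Printing Implicit Defensive.
Context {Atom : Type}.
Implicit Types (phi f : formula Atom) (d : move_sequence Atom).
Implicit Types (e x : statement Atom) (v : Atom -> bool).

Lemma depth_unique d m n : has_depth d m -> has_depth d n -> m = n.
Proof.
by move=> dm dn; apply/eqP; rewrite eqn_leq -(dn m) -(dm n) dm dn !leqnn.
Qed.

Lemma eta_some_leq phi d n i y :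
  dialogue phi d -> has_depth d n -> eta d i = Some y -> i <= n.
Proof.
by move=> dd dn di; have := dialogue_dom_eta dd i; rewrite di dn; case: leqP.
Qed.

Lemma extends_trans d d' d'' : extends d d' -> extends d' d'' -> extends d d''.
Proof.
move=> dd' d'd'' n dn; have [e1 e2] := dd' n dn.
by have [|-> ->] := d'd'' n; rewrite e1.
Qed.

(** This makes a node of a chain recoverable from its depth. *)
Lemma extends_same_depth phi d d' n : dialogue phi d -> dialogue phi d' ->
  has_depth d n -> has_depth d' n -> extends d d' -> d = d'.
Proof.
move=> D D' dn d'n dd'.
have E i : delta d i = delta d' i /\ eta d i = eta d' i.
  case: (boolP (i <= n)) => [lein|/negbTE gtin].
    by have [|-> ->] := dd' i; rewrite ?dn.
  have outside d0 : dialogue phi d0 -> has_depth d0 n ->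
      delta d0 i = None /\ eta d0 i = None.
    move=> D0 d0n; have d0i : delta d0 i = None.
      by have := d0n i; rewrite gtin; case: (delta d0 i).
    by have := dialogue_dom_eta D0 i; rewrite d0i; case: (eta d0 i).
  have [-> ->] := outside d D dn; have [-> ->] := outside d' D' d'n.
  by [].
case: d d' E {D D' dn d'n dd'} => [u w] [u' w'] /= E.
by congr MoveSequence; apply/funext => i; case: (E i).
Qed.

(** * The stalling principle *)

(** In a winning strategy, the moves preserving [Inv] are available at every
    depth: at even depth the strategy contains all moves of the Opponent, and
    at odd depth the one chosen move of the Proponent preserves [Inv].
    Dependent choice then builds a chain with a node at every depth.  Such a
    chain is maximal, so it is a branch, but it cannot consist of the initial
    segments of the finite dialogue that the branch should be. *)
Lemma opponent_stalls phi (Inv : set (move_sequence Atom)) :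
    Inv (Defs.root phi) ->
    (forall d n, N_dialogue phi d -> has_depth d n -> ~~ odd n -> Inv d ->
       exists2 d', child phi d d' & Inv d') ->
    (forall d d' n, has_depth d n -> odd n -> child phi d d' -> Inv d ->
       Inv d') ->
  ~ N_valid phi.
Proof.
move=> Inv0 InvO InvP [s [[s_tree s_root _] s_branch s_odd s_even]].
pose T := {d | s d /\ Inv d}.
(* Choosing a successor for every node, then iterating, is dependent choice. *)
have next (t : T) : {t' : T | child phi (sval t) (sval t')}.
  apply: cid; case: t => d [sd Id] /=.
  have [dN [n dn]] := s_tree _ sd.
  case: (boolP (odd n)) => n_par.
    have [d' [[sd' cd'] _]] := s_odd _ _ sd dn n_par.
    by exists (exist _ d' (conj sd' (InvP _ _ _ dn n_par cd' Id))).
  have [d' cd' Id'] := InvO _ _ dN dn n_par Id.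
  have [sd' _] := (s_even _ _ sd dn n_par d').2 cd'.
  by exists (exist _ d' (conj sd' Id')).
pose t0 : T := exist _ (Defs.root phi) (conj s_root Inv0).
pose x k := sval (iter k (fun t => sval (next t)) t0).
have xs k : s (x k) by rewrite /x; case: (iter _ _ _) => d [].
have xN k : N_dialogue phi (x k) by case: (s_tree _ (xs k)).
have xD k : dialogue phi (x k) by case: (xN k).
have x_child k : child phi (x k) (x k.+1) by rewrite /x iterS; case: (next _).
have x_depth k : has_depth (x k) k.
  elim: k => [|k IH]; first by case.
  have [_ _ _ [n [xn xn1]]] := x_child k.
  by rewrite -(depth_unique IH xn) in xn1.
have x_mono i j : i <= j -> extends (x i) (x j).
  move=> /subnK <-; elim: (j - i) => [|m IH]; first by [].
  by apply: extends_trans IH _; have [] := x_child (m + i).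
have [|d [dN [k dk] _] bd] := s_branch (range x).
  split.
  - by move=> _ [k _ <-].
  - by exists 0.
  - move=> _ _ [i _ <-] [j _ <-].
    by case: (leqP i j) => [/x_mono|/ltnW/x_mono]; [left|right].
  (* A node comparable with all [x n] coincides with the one at its depth. *)
  - move=> b' b's b'tot xb'; apply/seteqP; split=> // y b'y.
    have [[yD _ _] [n yn]] := s_tree _ (b's _ b'y).
    exists n => //; case: (b'tot y (x n) b'y) => [|yx|xy].
    + by apply: xb'; exists n.
    + by rewrite (extends_same_depth (n := n) yD (xD n)).
    + by rewrite (extends_same_depth (n := n) (xD n) yD).
(* The winning dialogue has depth [2k], whereas [x (2k+1)] lies in it. *)
have : range x (x k.*2.+1) by exists k.*2.+1.
rewrite bd => -[_ /(_ k.*2.+1)].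
rewrite x_depth leqnn => /(_ isT)[E _].
by have := dk k.*2.+1; rewrite E x_depth ltnn leqnn.
Qed.

(** * Moves of the Opponent *)

Definition play d n e (mz : nat * mode) : move_sequence Atom :=
  MoveSequence
    (fun i => if i == n.+1 then Some (Opponent, e) else delta d i)
    (fun i => if i == n.+1 then Some mz else eta d i).

Lemma extends_play d n e mz : has_depth d n -> extends d (play d n e mz).
Proof.
by move=> dn i; rewrite dn /= => lein; rewrite (ltn_eqF (_ : i < n.+1)).
Qed.

(** Sufficient conditions for a legal move of the Opponent at depth [n.+1].
    Attacks are restricted to the assertion just made, which cannot have been
    attacked yet, so D13 holds automatically; a defence may answer any earlier
    attack of the Proponent, answered before or not. *)
Definition O_legal d n e (mz : nat * mode) : Prop :=
  match mz with
  | (m, Attack) => m = n /\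
      exists p f,
        [/\ delta d m = Some (p, Form f), ~~ is_atomic f & attacks f e]
  | (m, Defend) => [/\ m <= n, ~~ odd m &
      exists k p f q e', [/\ eta d m = Some (k, Attack),
        delta d k = Some (p, Form f), delta d m = Some (q, e') &
        responds f e' e]]
  end.

Lemma child_play phi d n e mz : N_dialogue phi d -> has_depth d n ->
  ~~ odd n -> O_legal d n e mz -> child phi d (play d n e mz).
Proof.
move=> dN dn n_even legal; have [D d10 d13] := dN.
have ext := @extends_play d n e mz dn.
have stable i y : delta d i = Some y -> delta (play d n e mz) i = Some y.
  by move=> di; have [|->] := ext i; rewrite di.
have depth : has_depth (play d n e mz) n.+1.
  move=> i /=; case: eqVneq => [->|ne]; rewrite ?leqnn //.
  by rewrite dn [RHS]leq_eqVlt (negbTE ne).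
have le_mz : mz.1 <= n by case: mz legal {ext stable depth} => m [] [] // ->.
have etaE i y : eta (play d n e mz) i = Some y ->
    (i = n.+1 /\ y = mz) \/ eta d i = Some y.
  by move=> /=; case: eqP => [-> [<-]|]; [left|right].
have dN' : N_dialogue phi (play d n e mz).
  split; first split.
  - by rewrite /=; exact: dialogue_start D.
  - by move=> i j; rewrite !depth => /leq_trans; exact.
  - by move=> i /=; case: eqP => [->|] //; rewrite (dialogue_dom_eta D).
  - move=> i m z /etaE[[-> mzE]|/(dialogue_backward D)//].
    by move: le_mz; rewrite -mzE.
  - move=> i p x /=; case: eqP => [-> [<- _]|_ /(dialogue_sign D)//].
    by rewrite /mover /= n_even.
  - move=> i m /etaE[[-> mzE]|im].
      rewrite -mzE in legal; case: legal => -> [p [f [dm natf att]]].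
      rewrite subSnn; split => //; exists p, f, Opponent, e.
      by split => //=; rewrite ?eqxx // ; exact: stable.
    have [od [p [f [q [x [h1 h2 h3 h4]]]]]] := dialogue_attack D im.
    by split=> //; exists p, f, q, x; split => //; exact: stable.
  - move=> i m /etaE[[-> mzE]|im].
      rewrite -mzE in legal.
      case: legal => lemn m_even [k [p [f [q [e' [h1 h2 h3 h4]]]]]].
      split; first by rewrite subSn //= oddB // (negbTE n_even) (negbTE m_even).
      exists k; split.
        by have [|_ ->] := ext m; rewrite ?dn.
      exists p, f, q, e', Opponent, e.
      by split => //; try exact: stable; rewrite /= eqxx.
    have [od [k [km [p [f [q [x [r [y [h1 h2 h3 h4]]]]]]]]]] :=
      dialogue_defend D im.
    split=> //; exists k; split.
      by have [|_ ->] := ext m; rewrite ?h2.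
    by exists p, f, q, x, r, y; split => //; exact: stable.
  - move=> i a /=; case: eqP => [//|_ /d10[m lt dm]].
    by exists m => //; exact: stable.
  - move=> m i j m_even.
    (* Every earlier move refers to a position strictly below [n]. *)
    have fresh i' : eta d i' = Some (m, Attack) -> mz <> (m, Attack).
      move=> di' mzE; move: legal; rewrite mzE => -[mn _].
      have := dialogue_backward D di'; have := eta_some_leq D dn di'.
      by rewrite mn => le /(leq_ltn_trans le); rewrite ltnn.
    move=> /etaE[[-> mzE]|im] /etaE[[-> mzE']|jm] //.
    + by case: (fresh _ jm).
    + by case: (fresh _ im).
    + exact: d13 im jm.
by split => //; [split=> //; exists n|split=> //; exists n.+1|exists n].
Qed.

(** * N-validity implies classical validity *)

(** Symbolic attacks count as true: they commit a player to nothing. *)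
Definition holds v e : bool := if e is Form f then eval v f else true.

(** The attack points at the reason for falsity: a false conjunct, or a true
    antecedent or negated formula.  For a disjunction the defender chooses, but
    both disjuncts are false. *)
Lemma attack_false v f : eval v f = false -> ~~ is_atomic f ->
  exists e, [/\ attacks f e, holds v e &
                forall x, responds f e x -> holds v x = false].
Proof.
case: f => [a|f|f g|f g|f g] //= fF _.
- exists (Form f); split; [by constructor|by move: fF => /negbFE|].
  by move=> x H; inversion H.
- have /norP[/negbTE fF' /negbTE gF] := negbT fF.
  exists Query; split; [by constructor|by []|].
  by move=> x H; inversion H.
- have /nandP[/negbTE fF'|/negbTE gF] := negbT fF.
    exists AttackL; split; [by constructor|by []|].
    by move=> x H; inversion H; subst.
  exists AttackR; split; [by constructor|by []|].
  by move=> x H; inversion H; subst.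
- move: fF; case fT: (eval v f) => //= gF.
  exists (Form f); split; [by constructor|by []|].
  by move=> x H; inversion H; subst.
Qed.

(** Only an attack on an implication or a negation asserts something, and if
    what it asserts is true then a true implication has a true consequent,
    while a true negation cannot be attacked that way at all. *)
Lemma answer_true v f e : eval v f -> attacks f e ->
  (exists2 x, responds f e x & holds v x) \/ holds v e = false.
Proof.
move=> + att; case: att => {e} [f1 g|f1 g|f1 g|f1 g|f1] /=.
- by move=> /andP[fT _]; left; exists (Form f1); first by constructor.
- by move=> /andP[_ gT]; left; exists (Form g); first by constructor.
- move=> /orP[fT|gT]; left; first by exists (Form f1); first by constructor.
  by exists (Form g); first by constructor.
- case: (eval v f1); last by right.
  by move=> /= gT; left; exists (Form g); first by constructor.
- by move=> /negbTE; right.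
Qed.

(** At each of his positions, the Opponent plays according to [v]: what he
    asserts is true, and the Proponent can only answer his attacks falsely. *)
Definition faithful_at v d i : Prop :=
  (forall q e, delta d i = Some (q, e) -> holds v e) /\
  (forall m p f q e x, eta d i = Some (m, Attack) ->
     delta d m = Some (p, Form f) -> delta d i = Some (q, e) ->
     responds f e x -> holds v x = false).

Lemma faithful_extends phi v d d' i : dialogue phi d -> dialogue phi d' ->
  extends d d' -> isSome (delta d i) -> faithful_at v d i -> faithful_at v d' i.
Proof.
move=> D D' dd' di [F1 F2]; have [e1 e2] := dd' i di.
split=> [q e|m p f q e x]; rewrite ?e1 ?e2; first exact: F1.
move=> im; have := dialogue_backward D im => /ltnW lt.
have [|-> _] := dd' m; first exact: (dialogue_dom D lt di).
exact: F2.
Qed.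

Lemma faithful_step phi v d d' n : child phi d d' -> has_depth d n ->
  (forall i, odd i -> faithful_at v d i) ->
  (odd n.+1 -> faithful_at v d' n.+1) ->
  forall i, odd i -> faithful_at v d' i.
Proof.
case=> -[[D _ _] _] [[D' _ _] _] ext [n' [dn' d'n']] dn F Fn i i_odd.
move: d'n'; rewrite -(depth_unique dn dn') => {n' dn'} d'n'.
case: (ltngtP i n.+1) => [lt|gt|E].
- by apply: (faithful_extends D D' ext) (F i i_odd); rewrite dn.
- have d'i : delta d' i = None.
    by have := d'n' i; rewrite leqNgt gt; case: (delta _ _).
  by split=> *; congruence.
- by move: i_odd; rewrite E.
Qed.

Lemma N_valid_sound phi : N_valid phi -> classically_valid phi.
Proof.
move=> Nphi v; apply/negPn/negP => /negbTE phiF; move: Nphi.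
apply: (@opponent_stalls phi
  (fun d => forall i, odd i -> faithful_at v d i)).
- by move=> [|i] //= _; split.
- move=> d n dN dn n_even F; have [D d10 _] := dN.
  suff [e [mz [legal Fn]]] : exists e mz, O_legal d n e mz /\
      faithful_at v (play d n e mz) n.+1.
    have c := child_play dN dn n_even legal.
    exists (play d n e mz) => //.
    exact: (faithful_step c dn F).
  (* A false assertion by the Proponent can be attacked at once; this serves
     for the initial formula, for attacks and for defences alike. *)
  have counter q e : delta d n = Some (q, e) -> holds v e = false ->
      exists e' mz, O_legal d n e' mz /\ faithful_at v (play d n e' mz) n.+1.
    case: e => //= f dnf fF.
    have natf : ~~ is_atomic f.
      case: f dnf fF => //= a dnf aF.
      have qE : q = Proponent.
        by rewrite (dialogue_sign D dnf) /mover (negbTE n_even).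
      rewrite qE in dnf; have [m _ dm] := d10 _ _ dnf.
      have m_odd : odd m.
        by have := dialogue_sign D dm; rewrite /mover; case: odd.
      by have := (F m m_odd).1 _ _ dm; rewrite /= aF.
    have [e [att eT rF]] := attack_false fF natf.
    exists e, (n, Attack); split; first by split=> //; exists q, f.
    split=> /= [q' e'|m p g q' e' x]; rewrite eqxx; first by case=> _ <-.
    by case=> <-; rewrite (ltn_eqF (ltnSn n)) dnf => -[_ <-] [_ <-]; exact: rF.
  have [n0|n_gt0] := posnP n.
    apply: (counter Proponent (Form phi)) => //.
    by rewrite n0 (dialogue_start D).
  have : isSome (eta d n) by rewrite (dialogue_dom_eta D) dn leqnn -lt0n.
  case dne: (eta d n) => [[m []]|] // _.
    have [nm [p [f [q [e [dm _ dne' att]]]]]] := dialogue_attack D dne.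
    have m_lt := dialogue_backward D dne.
    have m_odd : odd m by move: nm; rewrite oddB 1?ltnW // (negbTE n_even).
    have fT := (F m m_odd).1 _ _ dm.
    have [[x rx xT]|eF] := answer_true fT att; last exact: counter dne' eF.
    exists x, (n, Defend); split; first by split=> //; exists m, p, f, q, e.
    by split=> [q' e'|m' p' g q' e' y] /=; rewrite eqxx => -[] // _ <-.
  have [nm [k [km [p [f [q [e [r [x [dk dm dnx rx]]]]]]]]]] :=
    dialogue_defend D dne.
  have m_lt := dialogue_backward D dne.
  have m_odd : odd m by move: nm; rewrite oddB 1?ltnW // (negbTE n_even).
  exact: (counter _ _ dnx ((F m m_odd).2 _ _ _ _ _ _ km dk dm rx)).
- move=> d d' n dn n_odd c F; apply: (faithful_step c dn F).
  by rewrite /= n_odd.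
Qed.

(** * A tautology that is not N-valid *)

(** The invariant says that the dialogue opens with the Opponent asserting
    [a /\ a] and the Proponent attacking that; from then on the Opponent repeats
    the response [a] to this attack. *)
Lemma conj_elim_not_N_valid (a : Atom) :
  ~ N_valid (Imp (And (Var a) (Var a)) (Var a)).
Proof.
set conj_a := And _ _; set phi := Imp _ _.
apply: (@opponent_stalls phi (fun d =>
  (isSome (delta d 1) -> delta d 1 = Some (Opponent, Form conj_a) /\
                         eta d 1 = Some (0, Attack)) /\
  (isSome (delta d 2) -> eta d 2 = Some (1, Attack)))).
- by [].
- move=> d [|[|n]] // dN dn n_even [I1 I2]; have [D _ _] := dN.
    exists (play d 0 (Form conj_a) (0, Attack)); last first.
      split=> //= d2; by have := dn 2; rewrite d2.
    apply: child_play => //; split=> //; exists Proponent, phi.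
    by split=> //; [exact: dialogue_start D|constructor].
  exists (play d n.+2 (Form (Var a)) (2, Defend)); last first.
    by split => /=; case: n dn n_even => [|n] //.
  apply: child_play => //; split=> //.
  have [d1 _] : delta d 1 = Some (Opponent, Form conj_a) /\
      eta d 1 = Some (0, Attack) by apply: I1; rewrite dn.
  have e2 : eta d 2 = Some (1, Attack) by apply: I2; rewrite dn.
  have [_ [p [f [q [e [d1' _ d2 att]]]]]] := dialogue_attack D e2.
  exists 1, p, f, q, e; split=> //.
  move: d1' att; rewrite d1 => -[_ <-] att.
  by inversion att; constructor.
- move=> d d' [|n] // dn n_odd c [I1 I2].
  have [[[D _ _] _] [[D' d10 _] _] ext _] := c.
  have [d1 e1] : delta d 1 = Some (Opponent, Form conj_a) /\
      eta d 1 = Some (0, Attack) by apply: I1; rewrite dn.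
  have [d1' e1'] : delta d' 1 = delta d 1 /\ eta d' 1 = eta d 1.
    by apply: ext; rewrite dn.
  rewrite d1' e1'; split=> // d2.
  case: n dn n_odd => [|n] dn n_odd; last first.
    have [|_ ->] := ext 2; first by rewrite dn.
    by apply: I2; rewrite dn.
  have : isSome (eta d' 2) by rewrite (dialogue_dom_eta D') d2.
  case e2: (eta d' 2) => [[[|[|m]] z]|] // _; last 1 first.
  + by have := dialogue_backward D' e2.
  + by case: z e2 => [/(dialogue_attack D')|/(dialogue_defend D')] [].
  case: z e2 => // e2.
  have [_ [k [km [p [f [q [e [r [x [dk dm d2x rx]]]]]]]]]] :=
    dialogue_defend D' e2.
  move: km dk dm; rewrite e1' e1 d1' d1 => -[<-].
  rewrite (dialogue_start D') => -[_ fE] [_ eE].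
  rewrite -fE -eE in rx; inversion rx; subst x.
  have rE := dialogue_sign D' d2x; rewrite rE in d2x.
  (* The only other candidate for move 2, the defence [a], violates D10. *)
  have [[|[|m]] // _] := d10 _ _ d2x.
    by rewrite (dialogue_start D').
  by rewrite d1' d1.
Qed.

End Play.

Theorem theorem6 (Atom : Type) (Atom_nonempty : inhabited Atom) :
  N_valid_formulas Atom `<` CL_valid_formulas Atom.
Proof.
have [a] := Atom_nonempty; split; first exact: N_valid_sound.
move=> /(_ (Imp (And (Var a) (Var a)) (Var a))) H.
by apply: (@conj_elim_not_N_valid _ a); apply: H => v /=; case: (v a).
Qed.
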